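(* Let $G=(V,E)$ and $H=(V',E')$ be two disjoint graphs and let $\tilde G=(\tilde V,\tilde E)$ be obtained by connecting $G$ and $H$ by an edge (bridge), i.e. $\tilde V=V\cup V'$ and $\tilde E=E\cup E'\cup\{\{x_0,z_0\}\}$ for some $x_0\in V$, $z_0\in V'$. Then $$\min(\nu(G),\nu(H))\le\nu(\tilde G)\le\max(\nu(G),\nu(H)).$$
   Context: All graphs $G=(V,E)$ are finite and simple with nonempty vertex set; $x\sim y$ denotes adjacency. $E^{or}(G)$ is the set of ordered pairs $(x,y)$ with $x\sim y$. A magnetic potential is a map $\sigma:E^{or}(G)\to S^1=\{z\in\mathbb{C}:|z|=1\}$ with $\sigma(y,x)=\sigma(x,y)^{-1}$. The magnetic Laplacian on functions $f:V\to\mathbb{C}$ is $\Delta^\sigma f(x)=\sum_{y\sim x}(f(x)-\sigma(x,y)f(y))$, and $\lambda_1^\sigma(G)$ is its smallest eigenvalue. The magneto-spectral height is $\nu(G)=\sup_\sigma\lambda_1^\sigma(G)$, over all magnetic potentials on $G$. *)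

(* Defs.v *)
From HB Require Import structures.
From mathcomp Require Import all_boot all_order all_algebra.
From mathcomp Require Import complex.
From mathcomp Require Import boolp classical_sets reals.

Set Implicit Arguments.
Unset Strict Implicit.
Unset Printing Implicit Defensive.

Import Order.TTheory GRing.Theory Num.Theory.
Local Open Scope ring_scope.
Local Open Scope complex_scope.

Record graph := Graph {
  vertex :> finType;
  adj : rel vertex;
  adj_sym : symmetric adj;
  adj_irrefl : irreflexive adj;
  vertex_gt0 : (0 < #|vertex|)%N
}.

(* [potfun] is a total function; its values at non-adjacent pairs are
   unconstrained and are never used. *)
Record potential (R : realType) (G : graph) := Potential {
  potfun :> G -> G -> R[i];
  potfun_unit : forall x y, adj x y -> `|potfun x y| = 1;
  potfun_inv : forall x y, adj x y -> potfun y x = (potfun x y)^-1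
}.

Section Laplacian.
Variables (R : realType) (G : graph).
Implicit Types (s : potential R G) (f : {ffun G -> R[i]^o}) (a : R[i]).

Definition laplacian s f : {ffun G -> R[i]^o} :=
  [ffun x => \sum_(y | adj x y) (f x - s x y * f y)].

Fact laplacian_linear s : linear (laplacian s).
Proof.
move=> a f g; apply/ffunP => x; rewrite !ffunE /= scaler_sumr -big_split /=.
apply: eq_bigr => y _; rewrite !ffunE.
have scE (c d : R[i]^o) : c *: d = (c : R[i]) * d by [].
by rewrite !scE mulrBr mulrDr opprD addrACA [s x y * (a * _)]mulrCA.
Qed.

HB.instance Definition _ s :=
  GRing.isLinear.Build _ _ _ _ (laplacian s) (laplacian_linear s).

Definition eigenval s a := passmx.leigenvalue (linfun (laplacian s)) a.

(* The infimum is attained, and all eigenvalues are real: see [lambda1P]. *)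
Definition lambda1 s : R := inf [set a : R | eigenval s a%:C].

Lemma eigenvalP s a :
  reflect (exists2 f, f != 0 & laplacian s f = a *: f) (eigenval s a).
Proof.
rewrite /eigenval /passmx.leigenvalue /passmx.leigenspace.
have kE f : (f \in lker (linfun (laplacian s) - a *: \1%VF)) =
            (laplacian s f == a *: f).
  by rewrite memv_ker add_lfunE opp_lfunE scale_lfunE id_lfunE lfunE subr_eq0.
apply: (iffP idP) => [Ha|[f f0 Hf]].
  exists (vpick (lker (linfun (laplacian s) - a *: \1%VF))); first by rewrite vpick0.
  by apply/eqP; rewrite -kE memv_pick.
by apply: contra_neq f0 => H; apply/eqP; rewrite -memv0 -H kE Hf.
Qed.

Lemma eigenval_real s a : eigenval s a -> a \is Num.real.
Proof.
case/eigenvalP => f f0 Hf.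
pose N := \sum_x f x * (f x)^*.
have N0 : N != 0.
  apply: contra f0 => /eqP N0; apply/eqP/ffunP => x; rewrite ffunE; apply/eqP.
  rewrite -normr_eq0 -sqrf_eq0 sqr_normc; apply/eqP.
  have H y : true -> 0 <= f y * (f y)^* by move=> _; exact: mulcJ_ge0.
  exact: (psumr_eq0P H N0).
pose Q := \sum_x laplacian s f x * (f x)^*.
have QE : Q = a * N.
  rewrite mulr_sumr; apply: eq_bigr => x _.
  by rewrite Hf ffunE /= mulrA.
have NJ : N^* = N.
  rewrite raddf_sum; apply: eq_bigr => x _ /=.
  by rewrite rmorphM /= conjcK mulrC.
have QJ : Q^* = Q.
  pose D := \sum_x \sum_(y | adj x y) f x * (f x)^*.
  pose S := \sum_x \sum_(y | adj x y) s x y * f y * (f x)^*.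
  have -> : Q = D - S.
    rewrite -sumrB; apply: eq_bigr => x _; rewrite ffunE mulr_suml -sumrB.
    by apply: eq_bigr => y _; rewrite mulrBl.
  rewrite rmorphB /=; congr (_ - _).
    rewrite rmorph_sum; apply: eq_bigr => x _; rewrite rmorph_sum.
    by apply: eq_bigr => y _ /=; rewrite rmorphM /= conjcK mulrC.
  rewrite rmorph_sum /S (exchange_big_dep predT) //=.
  apply: eq_bigr => x _; rewrite rmorph_sum; apply: eq_big => y.
    by rewrite adj_sym.
  move=> xy /=; rewrite !rmorphM /= conjcK (potfun_inv s xy).
  have n1 := potfun_unit s xy.
  have s0 : s x y != 0 by rewrite -normr_eq0 n1 oner_eq0.
  have -> : (s x y)^* = (s x y)^-1.
    by apply: (mulfI s0); rewrite -sqr_normc n1 expr1n divff.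
  exact: mulrAC.
move: QJ; rewrite QE rmorphM /= NJ => /(mulIf N0).
by case: a {Hf QE} => u v [] /eqP; rewrite complex_real eqNr.
Qed.

Lemma eigenval_le s a : eigenval s a -> a <= (#|G| * 2)%:R.
Proof.
move=> Ea; have ar := eigenval_real Ea.
case/eigenvalP: Ea => f f0 Hf.
have [x0 fx0] : exists x, f x != 0.
  apply/existsP; apply: contraR f0; rewrite negb_exists => /forallP H.
  by apply/eqP/ffunP => x; rewrite ffunE; have := H x; rewrite negbK => /eqP.
pose n x := ComplexField.Normc.normc (f x).
have nE x : (n x)%:C = `|f x| by [].
case: (@Order.TotalTheory.arg_maxP _ _ _ x0 xpredT n isT) => x _ xmax.
have le y : `|f y| <= `|f x| by rewrite -!nE lecR; exact: xmax.
have fx : 0 < `|f x| by apply: lt_le_trans (le x0); rewrite normr_gt0.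
apply: le_trans (real_ler_norm ar) _; rewrite -(ler_pM2r fx) -normrM.
have -> : a * f x = \sum_(y | adj x y) (f x - s x y * f y).
  by have := congr1 (fun g : {ffun _} => g x) Hf; rewrite !ffunE.
apply: le_trans (ler_norm_sum _ _ _) _.
rewrite natrM -mulrA mulr_natl -sumr_const.
rewrite [X in _ <= X](bigID (adj x)) /=.
apply: ler_wpDr; first by apply: sumr_ge0 => *; rewrite mulr_ge0 // ltW.
apply: ler_sum => y xy; apply: le_trans (ler_normB _ _) _.
by rewrite normrM (potfun_unit s xy) mul1r mulr_natl mulr2n lerD2l.
Qed.

Lemma eigenval_finite s :
  exists2 r : seq R[i], r != [::] & forall a, eigenval s a = (a \in r).
Proof.
pose V := {ffun G -> R[i]^o}.
pose e : (\dim {:V}).-tuple V := vbasis {:V}.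
have be : basis_of {:V} e := vbasisP _.
pose A := passmx.mxof e e (linfun (laplacian s)).
have EA a : eigenval s a = root (char_poly A) a.
  rewrite -eigenvalue_root_char /eigenval /passmx.leigenvalue.
  by rewrite (passmx.leigenspaceE be) passmx.vsof_eq0.
have dimV : \dim {:V} != 0%N.
  rewrite dimv_eq0 -vpick0; apply/eqP => v0.
  have /card_gt0P[x _] := vertex_gt0 G.
  have : ([ffun => 1] : V) \in {:V}%VS by exact: memvf.
  have /eqP -> : ({:V} == 0)%VS by rewrite -vpick0 v0.
  by rewrite memv0 => /eqP/ffunP/(_ x)/eqP; rewrite !ffunE oner_eq0.
have [r Hr] := closed_field_poly_normal (char_poly A).
have Emem a : eigenval s a = (a \in r).
  rewrite EA Hr rootZ ?lead_coef_eq0 ?monic_neq0 ?char_poly_monic //.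
  exact: root_prod_XsubC.
exists r => //; apply: contraNneq dimV => r0.
have := size_char_poly A; rewrite Hr r0 big_nil.
by rewrite (monicP (char_poly_monic A)) scale1r size_poly1 => -[->].
Qed.

Lemma lambda1P s :
  eigenval s (lambda1 s)%:C /\ forall a, eigenval s a -> (lambda1 s)%:C <= a.
Proof.
have [r r0 Er] := eigenval_finite s.
have [a0 a0r] : exists a, a \in r.
  by case: r r0 {Er} => // a r; exists a; rewrite mem_head.
have reE a : a \in r -> (complex.Re a)%:C = a.
  by rewrite -Er => /eigenval_real; exact: RRe_real.
have [m mr mmin] : exists2 m : R[i], m \in r & forall a : R[i], a \in r -> complex.Re m <= complex.Re a.
  case: (@Order.TotalTheory.arg_minP _ _ _ (SeqSub a0r) xpredT
    (fun a : seq_sub r => complex.Re (val a)) isT) => m _ H.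
  by exists (val m); [exact: valP | move=> a ar; exact: (H (SeqSub ar))].
have lE : lambda1 s = complex.Re m.
  apply/eqP; rewrite eq_le; apply/andP; split.
    apply: ge_inf; last by rewrite /= Er reE.
    by exists (complex.Re m) => b /=; rewrite Er => /mmin.
  by apply: lb_le_inf => [|b /=]; [exists (complex.Re m); rewrite /= Er reE|rewrite Er => /mmin].
rewrite lE reE // Er; split => // a; rewrite Er => ar.
by rewrite -(reE _ mr) -(reE _ ar) lecR mmin.
Qed.

(* The supremum is over a nonempty bounded set: see [nu_has_sup]. *)
Definition nu : R := sup (range lambda1).

Lemma nu_has_sup : has_sup (range lambda1).
Proof.
split.
  have u (x y : G) : adj x y -> `|(1 : R[i])| = 1 by rewrite normr1.
  have v (x y : G) : adj x y -> (1 : R[i]) = 1^-1 by rewrite invr1.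
  by exists (lambda1 (@Potential R G (fun _ _ => 1) u v)), (Potential u v).
exists (#|G| * 2)%:R => _ [s _ <-].
have [/eigenval_le + _] := lambda1P s.
by rewrite -(rmorph_nat (real_complex R)) lecR.
Qed.

End Laplacian.

Arguments nu : clear implicits.

Section Bridge.
Variables (G H : graph) (x0 : G) (z0 : H).

Definition bridge_adj : rel (G + H) := fun u v =>
  match u, v with
  | inl x, inl y => adj x y
  | inr z, inr w => adj z w
  | inl x, inr z => (x == x0) && (z == z0)
  | inr z, inl x => (x == x0) && (z == z0)
  end.

Fact bridge_sym : symmetric bridge_adj.
Proof. by case=> [x|z] [y|w] //=; rewrite adj_sym. Qed.

Fact bridge_irrefl : irreflexive bridge_adj.
Proof. by case=> [x|z] /=; rewrite adj_irrefl. Qed.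

Fact bridge_gt0 : (0 < #|{: G + H}|)%N.
Proof. by rewrite card_sum ltn_addr // vertex_gt0. Qed.

(* The disjoint union is realised on the sum of the two vertex types. *)
Definition bridge : graph := Graph bridge_sym bridge_irrefl bridge_gt0.

End Bridge.

(* Main.v *)
Require Import Defs.
From mathcomp Require Import all_boot all_order all_algebra.
From mathcomp Require Import complex spectral sesquilinear.
From mathcomp Require Import classical_sets reals.

Set Implicit Arguments.
Unset Strict Implicit.
Unset Printing Implicit Defensive.

Import Order.TTheory GRing.Theory Num.Theory.
Local Open Scope ring_scope.
Local Open Scope complex_scope.
Local Open Scope sesquilinear_scope.

(** The whole argument is the variational description of the lowest eigenvalue:
    [lambda1 s] is the minimum of [energy s f / sqnorm f] over nonzero [f],
    where [energy s f] is the quadratic form of the magnetic Laplacian.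
    Its lower half ([lambda1_energy]) comes from the spectral theorem for
    Hermitian matrices, and the minimum is attained at an eigenfunction
    ([lambda1_eigenfunction]).

    On a bridged graph the form splits ([energy_bridge]): it is the sum of
    the forms of the two restrictions of [F] plus the bridge term
    [`|F x0 - s x0 z0 * F z0| ^+ 2].

    For the lower bound, put arbitrary potentials on [G] and [H] and the value
    1 on the bridge.  The bridge term is nonnegative, so dropping it bounds the
    form from below by the minimum of the two lowest eigenvalues times the
    squared norm ([min_le_lambda1_glue]).

    For the upper bound, restrict a potential of the bridged graph to both
    sides and take lowest eigenfunctions [f] on [G] and [g] on [H].  One linear
    condition on two scalars always has a nonzero solution, so some nontrivial
    pair of multiples [a *: f], [b *: g] makes the bridge term vanish; their
    union is a test function with Rayleigh quotient at most the maximum of the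
    two lowest eigenvalues ([lambda1_le_max_restrict]).

    Taking suprema over potentials gives both inequalities. *)

(** * Rayleigh quotients of Hermitian matrices *)

Lemma rV_sqnormE (C : numClosedFieldType) (n : nat) (v : 'rV[C]_n) :
  (v *m v ^t*) 0 0 = \sum_i `|v 0 i| ^+ 2.
Proof. by rewrite mxE; apply: eq_bigr => i _; rewrite !mxE normCK. Qed.

(** In an orthonormal eigenbasis, the rows of the unitary matrix [P], the form is
    the sum of eigenvalues weighted by the squared moduli of the coordinates
    [w] of [v]. *)
Lemma hermitian_rayleigh (C : numClosedFieldType) (n : nat) (A : 'M[C]_n)
    (l : C) (v : 'rV[C]_n) :
  A \is hermsymmx -> (forall a, eigenvalue A a -> l <= a) ->
  l * (v *m v ^t*) 0 0 <= (v *m A *m v ^t*) 0 0.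
Proof.
move=> /hermitian_normalmx/orthomx_spectralP.
set P := spectralmx A; set d := spectral_diag A => AE lmin.
have Pu : P \is unitarymx := spectral_unitarymx A.
have eig i : eigenvalue A (d 0 i).
  apply/eigenvalueP; exists (row i P).
    have PA : P *m A = diag_mx d *m P.
      by rewrite [in LHS]AE !mulmxA mulmxV ?mul1mx // unitarymx_unit.
    by rewrite -row_mul PA row_mul row_diag_mx -scalemxAl -rowE.
  apply: contraTneq (unitarymx_unit Pu) => Pi0.
  rewrite -row_free_unit; apply/row_freePn; exists i.
  by rewrite Pi0 sub0mx.
pose w := v *m P ^t*.
have wE : w ^t* = P *m v ^t* by rewrite trmx_mul map_mxM trmxCK.
have -> : v *m v ^t* = w *m w ^t*.
  by rewrite wE mulmxA mulmxKtV.
have -> : v *m A *m v ^t* = w *m diag_mx d *m w ^t*.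
  by rewrite wE AE invmx_unitary // !mulmxA.
rewrite rV_sqnormE mulr_sumr mxE; apply: ler_sum => i _.
rewrite mul_mx_diag !mxE [X in _ <= X]mulrAC -normCK mulrC.
by rewrite ler_wpM2l ?exprn_ge0 //; apply: lmin.
Qed.

(** * The variational description of the lowest eigenvalue *)

Section Energy.
Variables (R : realType) (G : graph).
Implicit Types (s : potential R G) (f : {ffun G -> R[i]^o}).

Definition sqnorm f : R[i] := \sum_x `|f x : R[i]| ^+ 2.

Definition energy s f : R[i] :=
  \sum_x (laplacian s f x : R[i]) * Num.conj (f x : R[i]).

Lemma sqnorm_ge0 f : 0 <= sqnorm f.
Proof. by apply: sumr_ge0 => x _; rewrite exprn_ge0. Qed.

Lemma sqnorm_gt0 f : f != 0 -> 0 < sqnorm f.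
Proof.
move=> f0; rewrite lt_def sqnorm_ge0 andbT.
apply: contra f0 => /eqP N0; apply/eqP/ffunP => x; rewrite ffunE.
have H (y : G) : true -> 0 <= `|f y : R[i]| ^+ 2 by rewrite exprn_ge0.
by apply/eqP; rewrite -normr_eq0 -sqrf_eq0; apply/eqP/(psumr_eq0P H N0).
Qed.

Lemma energy_eigen s f (a : R[i]) :
  laplacian s f = a *: f -> energy s f = a * sqnorm f.
Proof.
move=> fE; rewrite /energy fE mulr_sumr; apply: eq_bigr => x _.
by rewrite ffunE normCK mulrA.
Qed.

Let x_ (i : 'I_#|G|) : G := enum_val i.

(** Vectors are rows and matrices act on the right, so this is the transpose of
    the usual matrix of the Laplacian in the basis of vertex indicators. *)
Definition laplacian_mx s : 'M[R[i]]_#|G| := \matrix_(i, j)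
  ((i == j)%:R * #|adj (x_ j)|%:R
   - (if adj (x_ j) (x_ i) then s (x_ j) (x_ i) else 0)).

Lemma laplacian_mxE s (f : {ffun G -> R[i]^o}) (v : 'rV[R[i]]_#|G|) :
  (forall i, f (enum_val i) = v 0 i) ->
  forall i, laplacian s f (enum_val i) = (v *m laplacian_mx s) 0 i.
Proof.
move=> fv i; rewrite ffunE mxE.
under [RHS]eq_bigr => j _ do rewrite mxE mulrBr.
rewrite !sumrB; congr (_ - _).
  rewrite [RHS](bigD1 i) //= [X in _ + X]big1 ?addr0 => [|j ji].
    by rewrite eqxx mul1r mulr_natr -fv -sumr_const.
  by rewrite (negPf ji) mul0r mulr0.
rewrite big_mkcond (reindex (@enum_val _ G)) /=; last first.
  exact: onW_bij (@enum_val_bij _).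
by apply: eq_bigr => j _; rewrite /x_; case: ifP; rewrite ?mulr0 // fv mulrC.
Qed.

(** The off-diagonal entries are conjugate because [s y x], the inverse of the
    unit complex number [s x y], is its conjugate. *)
Lemma laplacian_mx_herm s : laplacian_mx s \is hermsymmx.
Proof.
apply/is_hermitianmxP; rewrite expr0 scale1r; apply/matrixP => i j.
rewrite !mxE rmorphB rmorphM !rmorph_nat /= (eq_sym j).
congr (_ - _); first by case: eqP => [->|]; rewrite ?mul0r.
rewrite adj_sym; case: ifP => [ij|_]; last by rewrite conjC0.
rewrite (potfun_inv s ij) invC_norm (potfun_unit s ij).
by rewrite expr1n invr1 mul1r.
Qed.

Lemma laplacian_mx_eigenvalue s (a : R[i]) :
  eigenvalue (laplacian_mx s) a -> eigenval s a.
Proof.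
case/eigenvalueP => v vA v0; apply/eigenvalP.
exists [ffun x => v 0 (enum_rank x)].
  apply: contra v0 => /eqP/ffunP u0; apply/eqP/rowP => i.
  by have := u0 (enum_val i); rewrite !ffunE enum_valK mxE.
apply/ffunP => x; rewrite -[x]enum_rankK (@laplacian_mxE s _ v) => [|i].
  by rewrite vA !ffunE enum_valK mxE.
by rewrite ffunE enum_valK.
Qed.

Lemma lambda1_energy s f : (lambda1 s)%:C * sqnorm f <= energy s f.
Proof.
pose v : 'rV[R[i]]_#|G| := \row_i f (enum_val i).
have fv i : f (enum_val i) = v 0 i by rewrite mxE.
have lmin a : eigenvalue (laplacian_mx s) a -> (lambda1 s)%:C <= a.
  by move/laplacian_mx_eigenvalue; have [_] := lambda1P s; apply.
have := hermitian_rayleigh v (laplacian_mx_herm s) lmin.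
have ebij : {on predT, bijective (@enum_val _ G)}.
  exact: onW_bij (@enum_val_bij _).
have -> : sqnorm f = (v *m v ^t*) 0 0.
  rewrite rV_sqnormE /sqnorm (reindex (@enum_val _ G)) //=.
  by apply: eq_bigr => i _; rewrite fv.
suff -> : energy s f = (v *m laplacian_mx s *m v ^t*) 0 0 by [].
rewrite /energy mxE (reindex (@enum_val _ G)) //=.
by apply: eq_bigr => i _; rewrite (laplacian_mxE s fv) fv !mxE.
Qed.

Lemma lambda1_eigenfunction s :
  exists2 f, f != 0 & energy s f = (lambda1 s)%:C * sqnorm f.
Proof.
have [/eigenvalP[f f0 fE] _] := lambda1P s.
by exists f => //; exact: energy_eigen.
Qed.

Lemma lambda1_le_nu s : lambda1 s <= nu R G.
Proof. by apply: sup_upper_bound; [exact: nu_has_sup | exists s]. Qed.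

Lemma lt_nu (c : R) : c < nu R G -> exists s : potential R G, c < lambda1 s.
Proof.
have [nonempty _] := @nu_has_sup R G.
by case/(sup_gt nonempty) => _ [s _ <-] cs; exists s.
Qed.

Lemma sqnormZ (a : R[i]) f : sqnorm (a *: f) = `|a| ^+ 2 * sqnorm f.
Proof.
rewrite mulr_sumr; apply: eq_bigr => x _.
by rewrite ffunE normrM exprMn.
Qed.

Lemma energyZ s (a : R[i]) f : energy s (a *: f) = `|a| ^+ 2 * energy s f.
Proof.
rewrite /energy mulr_sumr linearZ; apply: eq_bigr => x _.
by rewrite !ffunE rmorphM /= mulrACA -normCK.
Qed.

End Energy.

(** * Splitting along the bridge *)

Section Bridge.
Variables (R : realType) (G H : graph) (x0 : G) (z0 : H).
Let B := bridge x0 z0.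
Implicit Types (s : potential R B) (sG : potential R G) (sH : potential R H).
Implicit Types (F : {ffun B -> R[i]^o}).

Definition restrictl F : {ffun G -> R[i]^o} := [ffun x => F (inl x)].
Definition restrictr F : {ffun H -> R[i]^o} := [ffun z => F (inr z)].

Definition join (f : {ffun G -> R[i]^o}) (g : {ffun H -> R[i]^o}) :
    {ffun B -> R[i]^o} :=
  [ffun u : B => match u with inl x => f x | inr z => g z end].

Definition potentiall s : potential R G :=
  @Potential R G (fun x y => s (inl x) (inl y))
    (fun x y => potfun_unit s (x := inl x) (y := inl y))
    (fun x y => potfun_inv s (x := inl x) (y := inl y)).

Definition potentialr s : potential R H :=
  @Potential R H (fun z w => s (inr z) (inr w))
    (fun z w => potfun_unit s (x := inr z) (y := inr w))
    (fun z w => potfun_inv s (x := inr z) (y := inr w)).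

(** The bridge carries the trivial phase, since any other phase there differs from
    it by a gauge change on one side. *)
Definition glue_fun sG sH (u v : B) : R[i] :=
  match u, v with
  | inl x, inl y => sG x y
  | inr z, inr w => sH z w
  | _, _ => 1
  end.

Fact glue_unit sG sH u v : adj u v -> `|glue_fun sG sH u v| = 1.
Proof.
by case: u v => [x|z] [y|w] //= uv; rewrite ?normr1 ?(potfun_unit _ uv).
Qed.

Fact glue_inv sG sH u v :
  adj u v -> glue_fun sG sH v u = (glue_fun sG sH u v)^-1.
Proof.
by case: u v => [x|z] [y|w] //= uv; rewrite ?invr1 ?(potfun_inv _ uv).
Qed.

Definition glue sG sH : potential R B :=
  Potential (@glue_unit sG sH) (@glue_inv sG sH).

Lemma sum_bridge (P : pred B) (E : B -> R[i]) :
  \sum_(u | P u) E u =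
    \sum_(x | P (inl x)) E (inl x) + \sum_(z | P (inr z)) E (inr z).
Proof. exact: big_sumType. Qed.

Lemma sqnorm_bridge F :
  sqnorm F = sqnorm (restrictl F) + sqnorm (restrictr F).
Proof.
by rewrite /sqnorm sum_bridge; congr (_ + _); apply: eq_bigr => x _;
  rewrite ffunE.
Qed.

Lemma laplacian_bridgel s F x :
  laplacian s F (inl x) = laplacian (potentiall s) (restrictl F) x
    + (if x == x0 then F (inl x0) - s (inl x0) (inr z0) * F (inr z0) else 0).
Proof.
rewrite ffunE sum_bridge /= ffunE; congr (_ + _).
  by apply: eq_bigr => y _; rewrite !ffunE.
case: eqP => [->|_] /=; last by rewrite big_pred0.
exact: big_pred1_eq.
Qed.

Lemma laplacian_bridger s F z :
  laplacian s F (inr z) = laplacian (potentialr s) (restrictr F) z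
    + (if z == z0 then F (inr z0) - s (inr z0) (inl x0) * F (inl x0) else 0).
Proof.
rewrite ffunE sum_bridge /= ffunE addrC; congr (_ + _).
  by apply: eq_bigr => y _; rewrite !ffunE.
case: eqP => [->|_] /=.
  by under eq_bigl do rewrite andbT; exact: big_pred1_eq.
by rewrite big_pred0 // => x; rewrite andbF.
Qed.

(** The bridge contributes [(a - t * b) * a^*] at [x0] and [(b - t^* * a) * b^*] at
    [z0], where [a = F x0], [b = F z0] and [t] is the potential of the bridge.
    As [t] has modulus 1, the second factor [b - t^* * a] is
    [- ((a - t * b) * t^* )], so that the two contributions add up to
    a squared modulus. *)
Lemma energy_bridge s F :
  energy s F = energy (potentiall s) (restrictl F)
    + energy (potentialr s) (restrictr F)
    + `|F (inl x0) - s (inl x0) (inr z0) * F (inr z0) : R[i]| ^+ 2.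
Proof.
have xz : adj (inl x0 : B) (inr z0) by rewrite /= !eqxx.
have n1 := potfun_unit s xz.
rewrite /energy sum_bridge.
under eq_bigr => x _ do rewrite laplacian_bridgel mulrDl.
under [X in _ + X]eq_bigr => z _ do rewrite laplacian_bridger mulrDl.
rewrite !big_split /= addrACA; congr (_ + _).
  by congr (_ + _); apply: eq_bigr => x _; congr (_ * Num.conj _);
    rewrite ffunE.
rewrite (bigD1 x0) //= eqxx big1 => [|x /negPf ->]; last by rewrite mul0r.
rewrite (bigD1 z0) //= eqxx big1 => [|x /negPf ->]; last by rewrite mul0r.
rewrite !addr0 (potfun_inv s xz) invC_norm n1 expr1n invr1 mul1r normCK.
set a : R[i] := F _; set b : R[i] := F _.
move: n1; set t : R[i] := potfun _ _ _; move=> n1.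
have tt : t * Num.conj t = 1 by rewrite -normCK n1 expr1n.
rewrite rmorphB rmorphM /= mulrBr; congr (_ + _).
have -> : b - Num.conj t * a = - ((a - t * b) * Num.conj t).
  by rewrite mulrBl opprB mulrAC tt mul1r [a * _]mulrC.
by rewrite mulNr mulrA.
Qed.

(** Each side is estimated at the restriction of a lowest eigenfunction of the
    bridged graph; a restriction may vanish, so the estimates use
    [lambda1_energy] in its multiplied-out form rather than quotients. *)
Lemma min_le_lambda1_glue sG sH :
  Num.min (lambda1 sG) (lambda1 sH) <= lambda1 (glue sG sH).
Proof.
have [F F0 FE] := lambda1_eigenfunction (glue sG sH).
rewrite -lecR -(ler_pM2r (sqnorm_gt0 F0)) -FE.
rewrite energy_bridge sqnorm_bridge mulrDr.
apply: ler_wpDr; first by rewrite exprn_ge0.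
have EG : energy (potentiall (glue sG sH)) (restrictl F) =
          energy sG (restrictl F) by [].
have EH : energy (potentialr (glue sG sH)) (restrictr F) =
          energy sH (restrictr F) by [].
rewrite EG EH; apply: lerD.
  apply: le_trans (lambda1_energy _ _).
  by rewrite ler_wpM2r ?sqnorm_ge0 // lecR ge_min lexx.
apply: le_trans (lambda1_energy _ _).
by rewrite ler_wpM2r ?sqnorm_ge0 // lecR ge_min lexx orbT.
Qed.

(** Lowest eigenfunctions of the two sides, scaled to agree across the bridge up
    to its potential, form a test function without bridge energy. *)
Lemma lambda1_le_max_restrict s :
  lambda1 s <= Num.max (lambda1 (potentiall s)) (lambda1 (potentialr s)).
Proof.
set m := Num.max _ _.
suff [F F0 FE] : exists2 F : {ffun B -> R[i]^o},
    F != 0 & energy s F <= m%:C * sqnorm F.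
  rewrite -lecR -(ler_pM2r (sqnorm_gt0 F0)).
  exact: le_trans (lambda1_energy s F) FE.
have [f f0 fE] := lambda1_eigenfunction (potentiall s).
have [g g0 gE] := lambda1_eigenfunction (potentialr s).
set t : R[i] := s (inl x0) (inr z0).
have [a [b [ab0 ab]]] : exists a b : R[i],
    (a != 0) || (b != 0) /\ a * (f x0 : R[i]) = t * (b * (g z0 : R[i])).
  (* If [f] vanishes at [x0], it already matches the zero function on [H];
     otherwise [g] itself is kept and [f] is rescaled. *)
  have [fx0|fx0] := eqVneq (f x0 : R[i]) 0.
    by exists 1, 0; rewrite oner_eq0 fx0 mul0r !mulr0.
  exists (t * g z0 / f x0), 1.
  by rewrite oner_eq0 orbT divfK // mul1r.
pose F := join (a *: f) (b *: g).
have Fl : restrictl F = a *: f by apply/ffunP => x; rewrite !ffunE.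
have Fr : restrictr F = b *: g by apply/ffunP => z; rewrite !ffunE.
exists F.
  apply: contraTneq ab0 => FE0; rewrite negb_or !negbK.
  have af0 : a *: f = 0 by rewrite -Fl FE0; apply/ffunP => x; rewrite !ffunE.
  have bg0 : b *: g = 0 by rewrite -Fr FE0; apply/ffunP => x; rewrite !ffunE.
  move/eqP: af0; rewrite scaler_eq0 (negPf f0) orbF => ->.
  by move/eqP: bg0; rewrite scaler_eq0 (negPf g0) orbF => ->.
have -> : energy s F =
    energy (potentiall s) (a *: f) + energy (potentialr s) (b *: g).
  rewrite energy_bridge Fl Fr !ffunE -/t.
  have -> : (a *: f x0 - t * (b *: g z0) : R[i]) = 0.
    by apply/eqP; rewrite subr_eq0; apply/eqP; exact: ab.
  by rewrite normr0 expr0n addr0.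
rewrite sqnorm_bridge Fl Fr !energyZ !sqnormZ fE gE mulrDr.
by apply: lerD; rewrite [X in _ <= X]mulrCA ler_wpM2l ?exprn_ge0 //;
  rewrite ler_wpM2r ?lecR ?le_max ?lexx ?orbT // sqnorm_ge0.
Qed.

End Bridge.

Theorem lemma4p3 (R : realType) (G H : graph) (x0 : G) (z0 : H) :
  Num.min (nu R G) (nu R H) <= nu R (bridge x0 z0)
  /\ nu R (bridge x0 z0) <= Num.max (nu R G) (nu R H).
Proof.
split; rewrite leNgt; apply/negP.
  rewrite lt_min => /andP[/lt_nu[sG ltG] /lt_nu[sH ltH]].
  have /lt_le_trans/(_ (min_le_lambda1_glue x0 z0 sG sH)) :
      nu R (bridge x0 z0) < Num.min (lambda1 sG) (lambda1 sH).
    by rewrite lt_min ltG.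
  by rewrite ltNge lambda1_le_nu.
case/lt_nu => s; apply/negP; rewrite -leNgt.
apply: le_trans (lambda1_le_max_restrict s) _.
by rewrite ge_max !le_max !lambda1_le_nu orbT.
Qed.
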